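(* Let $\sigma:\mathbb{R}\to\mathbb{R}$ satisfy $|\sigma(x)-\sigma(y)|\le K|x-y|$ for all $x,y\in\mathbb{R}$, for some $K>0$. Let $d,m,N\ge 1$ be integers, let $T>0$ and $r>0$, and let $A_i,W_i\in\mathbb{R}^{d\times d}$, $b_i\in\mathbb{R}^d$ for $i=1,\dots,m$. Let $\Sigma$, the $\frac{T}{N}$-periodic time-dependent vector field $Q_t$ and the vector field $\tilde{Q}$ be as defined in the context. Assume that the solution $z$ of $\dot z(t)=Q_t(z(t))$ and the solution $y$ of $\dot y(t)=\tilde Q(y(t))$ on $[0,T]$ satisfy $z(0),y(0)\in B_r(0)$. Then $$|z(t)-y(t)|\le\Big(2\frac{T}{N}X+\tilde K X\frac{T^2}{2N}\Big)e^{\tilde K T}$$ for all $t\in[0,T]$, where the constants are given by $$X=c+L(r+ct)e^{Lt},\qquad \tilde K=m\sup_{i\in\{1,\dots,m\}}K\|A_i\|_1\|W_i\|_1,$$ $$c=m\sup_{i\in\{1,\dots,m\}}\|A_i\|_1|\Sigma(b_i)|,\qquad L=m\sup_{i\in\{1,\dots,m\}}K\|A_i\|_1\|W_i\|_1.$$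
   Context: For $x\in\mathbb{R}^d$, $|x|$ denotes the $\ell^1$ norm; for a matrix $A\in\mathbb{R}^{d\times d}$, $\|A\|_1$ is the operator norm induced by the $\ell^1$ norm on $\mathbb{R}^d$. $B_r(0)=\{x\in\mathbb{R}^d: |x|<r\}$. The map $\Sigma:\mathbb{R}^d\to\mathbb{R}^d$ is $\Sigma(x)=[\sigma(x_1),\dots,\sigma(x_d)]^T$. The $\frac{T}{N}$-periodic (in $t$), piecewise-constant-in-time vector field $Q_t$ is defined by $$Q_{t+\frac{nT}{N}}(x)=m\,A_i\Sigma(W_ix+b_i)\quad\text{for } t\in\Big[\tfrac{(i-1)T}{mN},\tfrac{iT}{mN}\Big),$$ for all $n\in\{0,\dots,N-1\}$, $i\in\{1,\dots,m\}$ and $x\in\mathbb{R}^d$. The averaged vector field is $\tilde Q(x)=\sum_{i=1}^m A_i\Sigma(W_ix+b_i)$. Since $Q_t$ is discontinuous in $t$, a solution of $\dot z(t)=Q_t(z(t))$ means an absolutely continuous function satisfying the equation for almost every $t\in[0,T]$.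
   Formalization: The formal theorem also assumes z(0)=y(0); with different initial values in B_r(0) the claim fails, e.g. all A_i=0 makes X=0 and both solutions constant, so the bound would force |z(0)-y(0)|≤0. *)

(* Defs.v *)
From HB Require Import structures.
From mathcomp Require Export all_boot all_order all_algebra.
From mathcomp Require Export all_classical all_reals all_analysis.

Set Implicit Arguments.
Unset Strict Implicit.
Unset Printing Implicit Defensive.

Import Order.TTheory GRing.Theory Num.Theory.
Export numFieldNormedType.Exports.

Local Open Scope classical_set_scope.
Local Open Scope ring_scope.

(* The library norm `|x| on 'cV[R]_d is the sup norm. *)
Definition l1norm (R : realType) (d : nat) (x : 'cV[R]_d) : R :=
  \sum_(i < d) `|x i 0|.

Definition l1opnorm (R : realType) (d : nat) (A : 'M[R]_d) : R :=
  sup [set l1norm (A *m x) | x in [set x : 'cV[R]_d | l1norm x <= 1]].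

Definition l1ball (R : realType) (d : nat) (r : R) : set 'cV[R]_d :=
  [set x | l1norm x < r].

Definition Sigma (R : realType) (d : nat) (sigma : R -> R) (x : 'cV[R]_d)
    : 'cV[R]_d :=
  \col_(i < d) sigma (x i 0).

Definition layer (R : realType) (d : nat) (sigma : R -> R) (A W : 'M[R]_d)
    (b x : 'cV[R]_d) : 'cV[R]_d :=
  A *m Sigma sigma (W *m x + b).

(* The representative of t modulo p in [0, p[, for p > 0. *)
Definition phase (R : realType) (p t : R) : R :=
  t - (Num.floor (t / p))%:~R * p.

(* The time-dependent field Q_t. Indices i : 'I_m start at 0, so that slot i is
   [iT/(mN), (i+1)T/(mN)[; for each t, exactly one term of the sum is present
   (see switched_fieldE). *)
Definition switched_field (R : realType) (d m N : nat) (T : R)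
    (sigma : R -> R) (A W : 'I_m -> 'M[R]_d) (b : 'I_m -> 'cV[R]_d)
    (t : R) (x : 'cV[R]_d) : 'cV[R]_d :=
  m%:R *: \sum_(i < m | i%:R * T / (m%:R * N%:R) <= phase (T / N%:R) t
                        < i.+1%:R * T / (m%:R * N%:R))
            layer sigma (A i) (W i) (b i) x.

Definition averaged_field (R : realType) (d m : nat)
    (sigma : R -> R) (A W : 'I_m -> 'M[R]_d) (b : 'I_m -> 'cV[R]_d)
    (x : 'cV[R]_d) : 'cV[R]_d :=
  \sum_(i < m) layer sigma (A i) (W i) (b i) x.

Definition absolutely_continuous_on (R : realType) (d : nat) (a b : R)
    (f : R -> 'cV[R]_d) : Prop :=
  forall e : R, 0 < e -> exists2 delta : R, 0 < delta &
    forall (n : nat) (u v : 'I_n -> R),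
      (forall k, a <= u k /\ u k <= v k /\ v k <= b) ->
      trivIset [set: 'I_n] (fun k => `]u k, v k[%classic) ->
      \sum_(k < n) (v k - u k) < delta ->
      \sum_(k < n) l1norm (f (v k) - f (u k)) < e.

(* Only the values of z on [0, T] matter: the endpoints, where is_derive would
   look outside the interval, are negligible. *)
Definition is_solution (R : realType) (d : nat)
    (F : R -> 'cV[R]_d -> 'cV[R]_d) (T : R) (z : R -> 'cV[R]_d) : Prop :=
  absolutely_continuous_on 0 T z /\
  {ae @lebesgue_measure R, forall t : R,
    t \in `[0, T] -> is_derive t 1 z (F t (z t))}.

Lemma phaseD (R : realType) (p t : R) (n : int) :
  0 < p -> phase p (t + n%:~R * p) = phase p t.
Proof.
move=> p0; rewrite /phase mulrDl mulfK ?gt_eqF// floorDrz ?intr_int//.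
rewrite intrKfloor intrD mulrDl opprD addrACA subrr addr0//.
Qed.

Lemma phase_id (R : realType) (p t : R) : 0 <= t < p -> phase p t = t.
Proof.
move=> /andP[t0 tp]; have p0 : 0 < p by exact: le_lt_trans tp.
rewrite /phase (_ : Num.floor _ = 0%Z) ?mul0r ?subr0//.
by apply/floor_def; rewrite add0r divr_ge0 ?(ltW p0)//= ltr_pdivrMr ?mul1r.
Qed.

Lemma switched_field_periodic (R : realType) (d m N : nat) (T : R)
    (sigma : R -> R) (A W : 'I_m -> 'M[R]_d) (b : 'I_m -> 'cV[R]_d)
    (t : R) (x : 'cV[R]_d) :
  (0 < N)%N -> 0 < T ->
  switched_field N T sigma A W b (t + T / N%:R) x =
  switched_field N T sigma A W b t x.
Proof.
move=> N0 T0; have h0 : 0 < T / N%:R by rewrite divr_gt0 ?ltr0n.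
by rewrite /switched_field -(phaseD t 1 h0) mul1r.
Qed.

Lemma switched_fieldE (R : realType) (d m N : nat) (T : R)
    (sigma : R -> R) (A W : 'I_m -> 'M[R]_d) (b : 'I_m -> 'cV[R]_d)
    (n : nat) (i : 'I_m) (t : R) (x : 'cV[R]_d) :
  (0 < N)%N -> 0 < T ->
  i%:R * T / (m%:R * N%:R) <= t < i.+1%:R * T / (m%:R * N%:R) ->
  switched_field N T sigma A W b (t + n%:R * T / N%:R) x =
  m%:R *: (A i *m Sigma sigma (W i *m x + b i)).
Proof.
move=> N0 T0 /andP[it ti].
have m0 : (0 < m)%N by case: (i) => k; exact: leq_ltn_trans.
have mN0 : 0 < m%:R * N%:R :> R by rewrite mulr_gt0 ?ltr0n.
have h0 : 0 < T / N%:R by rewrite divr_gt0 ?ltr0n.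
have tp : 0 <= t < T / N%:R.
  apply/andP; split.
    by apply: le_trans it; rewrite divr_ge0 ?mulr_ge0 ?(ltW T0) ?ler0n.
  apply: (lt_le_trans ti); rewrite ler_pdivrMr// [leRHS]mulrC.
  rewrite -mulrA [N%:R * _]mulrC divfK ?pnatr_eq0 -?lt0n//.
  by rewrite ler_pM2r// ler_nat.
rewrite /switched_field -mulrA (phaseD t n%:Z h0) (phase_id tp).
rewrite (big_pred1 i) // => j; apply/idP/eqP => [/andP[jt tj]|->]; last first.
  by rewrite it ti.
have aux (a c : nat) : a%:R * T / (m%:R * N%:R) <= t ->
    t < c.+1%:R * T / (m%:R * N%:R) -> (a <= c)%N.
  move=> h1 h2; have := le_lt_trans h1 h2.
  by rewrite ltr_pM2r ?invr_gt0// ltr_pM2r// ltr_nat ltnS.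
by apply/val_inj/eqP; rewrite eqn_leq !aux.
Qed.

(* Main.v *)
Require Import Defs.
From mathcomp Require Import ring lra.
Set Implicit Arguments.
Unset Strict Implicit.
Unset Printing Implicit Defensive.
Import Order.TTheory GRing.Theory Num.Theory.
Local Open Scope classical_set_scope.
Local Open Scope ring_scope.

(** Write h = T / N and w = z - y.  Almost everywhere
      w'(s) = [Q_s(z(s)) - Q_s(y(s))] + [Q_s(y(s)) - Q~(y(s))].
    The first bracket is at most L |w(s)|.  The second one has mean zero over a
    period once y is frozen at a point.  Gronwall's inequality for Q~ bounds
    |y'| by X on [0, t] (growth_bound, increment_bound), so freezing y at the
    middle of a period costs at most 2 L X |s - mid|, whose integral over the
    period is L X h^2 / 2; over N periods this gives the term L X T^2 / (2 N).
    The midpoint is what makes this constant sharp enough: an endpoint would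
    cost twice as much.  The frozen bracket has an explicit primitive, the
    corrector: it vanishes at both ends of the period and is at most 2 h X
    inside.  So z - y - corrector satisfies a Gronwall inequality on each
    period (averaging_step).  The term 2 h X is needed only to absorb the value
    of the corrector inside a period, hence it is kept as an additive constant
    while the periods are chained and it enters the final bound only once
    (averaging_bound).

    The solutions are merely absolutely continuous, so the differential
    inequalities hold almost everywhere.  They are integrated without an
    integral: an absolutely continuous function whose upper slope is almost
    everywhere nonpositive is nonincreasing (upper_ac_nonincreasing).  To see
    this, cover the exceptional null set by an open set of small measure and cut
    [a, b] by Cousin's lemma into cells that either lie in this open set, where
    absolute continuity bounds the total increment, or carry almost no
    increment.  Gronwall's inequality follows (gronwall_le), for functions built
    from the l1 norm, which need not be differentiable. *)

(** * Almost everywhere slope bounds *)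

(** A cell straddling the supremum of the points that can be reached from a by a
    chain of admissible cells reaches beyond it, unless the supremum is b. *)
Lemma cousin_partition (R : realType) (a b : R) (P : R -> R -> Prop) :
  a <= b ->
  (forall s, a <= s -> s <= b -> exists2 delta, 0 < delta &
     forall u v, a <= u -> u <= s -> s <= v -> v <= b -> v - u < delta ->
       P u v) ->
  exists (n : nat) (t : nat -> R), [/\ t 0%N = a, t n = b &
    forall k, (k < n)%N -> t k <= t k.+1 /\ P (t k) (t k.+1)].
Proof.
move=> ab locP.
pose reach s := exists (n : nat) (t : nat -> R), [/\ t 0%N = a, t n = s &
    forall k, (k < n)%N -> t k <= t k.+1 /\ P (t k) (t k.+1)].
pose S := [set s | a <= s /\ s <= b /\ reach s].
have Sa : S a by split => //; split => //; exists 0%N, (fun=> a).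
have supS : has_sup S by split; [exists a | exists b => s [_ []]].
have ac : a <= sup S by apply: (ub_le_sup _ Sa); case: supS.
have cb : sup S <= b.
  by apply: ge_sup; [exists a | move=> s [_ []]].
have [delta d0 Pd] := locP _ ac cb.
have d20 : 0 < delta / 2 by lra.
have [s [sa [sb [n [t [t0 tn tP]]]]] cs] := sup_adherent d20 supS.
have sc : s <= sup S.
  apply: ub_le_sup; first by case: supS.
  by split => //; split => //; exists n, t.
pose v := Num.min (sup S + delta / 4) b.
have cv : sup S <= v by rewrite /v le_min cb andbT; lra.
have vb : v <= b by rewrite /v ge_min lexx orbT.
have vc : v <= sup S + delta / 4 by rewrite /v ge_min lexx.
have Psv : P s v by apply: Pd => //; lra.
have Sv : S v.
  split; [lra | split => //].
  exists n.+1, (fun k => if (k <= n)%N then t k else v).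
  split => //=; first by rewrite ltnn.
  move=> k; rewrite ltnS => kn; rewrite kn.
  case: ltnP => [/tP//|nk].
  have -> : k = n by apply/eqP; rewrite eqn_leq kn nk.
  by rewrite tn; split => //; lra.
have vS : v <= sup S by apply: ub_le_sup => //; case: supS.
suff -> : b = v by case: Sv => _ [].
have [bv|bv] := leP b (sup S + delta / 4); first by rewrite /v min_r.
have : v = sup S + delta / 4 by rewrite /v min_l // ltW.
lra.
Qed.

(** The positive-part variation that absolute continuity controls.  Unlike
    absolute continuity it is stable under adding any nonincreasing function,
    and positive parts make it stable under bounded nonnegative weights. *)
Definition upper_ac (R : realType) (a b : R) (g : R -> R) : Prop :=
  forall e : R, 0 < e -> exists2 delta : R, 0 < delta &
    forall (n : nat) (u v : 'I_n -> R),
      (forall k, a <= u k /\ u k <= v k /\ v k <= b) ->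
      trivIset [set: 'I_n] (fun k => `]u k, v k[%classic) ->
      \sum_(k < n) (v k - u k) < delta ->
      \sum_(k < n) Num.max 0 (g (v k) - g (u k)) < e.

(** The bound k on the upper derivative at s relative to [a, b], in the form
    that compares two points on either side of s: such pairs are the ends of the
    cells of a tagged partition. *)
Definition slope_le (R : realType) (a b : R) (g : R -> R) (s k : R) : Prop :=
  forall e : R, 0 < e -> exists2 delta : R, 0 < delta &
    forall u v, a <= u -> u <= s -> s <= v -> v <= b -> v - u < delta ->
      g v - g u <= (k + e) * (v - u).

Lemma chain_le (R : realType) (n : nat) (t : nat -> R) (i j : nat) :
  (forall k, (k < n)%N -> t k <= t k.+1) -> (i <= j)%N -> (j <= n)%N ->
  t i <= t j.
Proof.
move=> tS; elim: j => [|j IH]; first by rewrite leqn0 => /eqP ->.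
rewrite leq_eqVlt => /predU1P[-> //|]; rewrite ltnS => ij jn.
by apply: le_trans (IH ij (ltnW jn)) (tS _ jn).
Qed.

Lemma trivIset_chain (R : realType) (n : nat) (t : nat -> R) (v : 'I_n -> R) :
  (forall k, (k < n)%N -> t k <= t k.+1) -> (forall k : 'I_n, v k <= t k.+1) ->
  trivIset [set: 'I_n] (fun k => `]t k, v k[%classic).
Proof.
move=> tS vt.
have wl (i j : 'I_n) x : (i < j)%N -> `]t i, v i[%classic x ->
    `]t j, v j[%classic x -> False.
  move=> ij; rewrite /= !in_itv /= => /andP[_ xi] /andP[xj _].
  have := lt_le_trans xi (vt i).
  have /= := chain_le tS ij (ltnW (ltn_ord j)); lra.
apply/trivIsetP => i j _ _ ij; apply/seteqP; split => // x [xi xj].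
have [lij|lij|eij] := ltngtP i j; first exact: wl lij xi xj.
- exact: wl lij xj xi.
- by move: ij; rewrite (val_inj eij) eqxx.
Qed.

Lemma sum_itv_le_measure (R : realType) (n : nat) (u v : 'I_n -> R)
    (U : set R) (delta : R) :
  measurable U -> (@lebesgue_measure R U < delta%:E)%E ->
  (forall k, u k <= v k) ->
  (forall k, `]u k, v k[%classic `<=` U) ->
  trivIset [set: 'I_n] (fun k => `]u k, v k[%classic) ->
  \sum_(k < n) (v k - u k) < delta.
Proof.
move=> mU Ud uv uvU tuv; rewrite -lte_fin; apply: le_lt_trans Ud.
rewrite -sumEFin.
have -> : (\sum_(k < n) (v k - u k)%:E = 
           \sum_(k < n) lebesgue_measure (`]u k, v k[%classic : set R))%E.
  apply: eq_bigr => k _; rewrite lebesgue_measure_itv /= lte_fin.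
  case: ltP => [_|vu]; first by rewrite EFinB.
  by rewrite (@le_anti _ _ (v k) (u k)) ?vu ?uv // subrr.
rewrite -measure_bigsetU_ord //; apply: le_measure => //.
- rewrite inE; apply: bigsetU_measurable => k _; exact: measurable_itv.
- by rewrite inE.
- apply: (big_ind (fun A => A `<=` U));
    [exact: sub0set | | by move=> k _; exact: uvU].
  by move=> A B AU BU; rewrite subUset; split.
Qed.

(** A Cousin partition splits the increment of g into cells inside an open set
    of measure less than delta around the exceptional null set, which contribute
    at most e / 2 by absolute continuity, and cells where the slope is at most
    eta, which contribute at most eta * (b - a) <= e / 2. *)
Lemma upper_ac_nonincreasing (R : realType) (a b : R) (g : R -> R) :
  a <= b -> upper_ac a b g ->
  {ae @lebesgue_measure R, forall s, a <= s -> s <= b -> slope_le a b g s 0} ->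
  g b <= g a.
Proof.
move=> ab acg aeg; apply/ler_addgt0Pr => e e0.
have e20 : 0 < e / 2 by lra.
have [delta d0 gd] := acg _ e20.
case: aeg => Z [mZ Z0 subZ].
have [U [oU ZU Ud]] := lebesgue_regularity_outer mZ
  (eq_ind_r (fun x => x < +oo)%E (ltry 0) Z0) d0.
have mU : measurable U by exact: measurable_realfun.open_measurable.
have {}Ud : (@lebesgue_measure R U < delta%:E)%E.
  rewrite -(setDUK ZU); apply: le_lt_trans (Ud).
  apply: le_trans (measureU2 _ mZ (measurableD mU mZ)) _.
  rewrite [X in (X + _)%E](_ : _ = 0%E) ?add0e //; exact: Z0.
pose eta := e / (2 * (b - a + 1)).
have ba1 : 0 < b - a + 1 by lra.
have eta0 : 0 < eta by rewrite /eta divr_gt0 // mulr_gt0.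
pose bad u v := `[u, v]%classic `<=` U.
have [n [t [t0 tn tP]]] : exists (n : nat) (t : nat -> R),
  [/\ t 0%N = a, t n = b & forall k, (k < n)%N -> t k <= t k.+1 /\
   (bad (t k) (t k.+1) \/ g (t k.+1) - g (t k) <= eta * (t k.+1 - t k))].
  apply: (@cousin_partition R a b
    (fun u v => bad u v \/ g v - g u <= eta * (v - u))) => // s sa sb.
  have [sU|sU] := pselect (U s).
    have [r /= r0 rU] : nbhs_ball s U by rewrite nbhs_ballE; exact: oU.
    exists r => // u v au us sv vb uvr; left => x /=.
    rewrite in_itv /= => /andP[ux xv].
    apply: rU; rewrite /ball /= ltr_distlC; apply/andP; split; lra.
  have sl : slope_le a b g s 0.
    apply: contrapT => nsl; apply: sU; apply: ZU; apply: subZ => /= h.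
    by apply: nsl; exact: h.
  have [r r0 rg] := sl _ eta0.
  exists r => // u v au us sv vb uvr; right.
  by have := rg u v au us sv vb uvr; rewrite add0r.
(* good cells are shrunk to a point, so that the family stays indexed by 'I_n *)
pose isbad (k : 'I_n) := `[< bad (t k) (t k.+1) >].
pose u (k : 'I_n) := t k.
pose v (k : 'I_n) := if isbad k then t k.+1 else t k.
have tS k : (k < n)%N -> t k <= t k.+1 by move=> /tP [].
have ta (k : 'I_n) : a <= t k.
  by rewrite -t0; apply: (chain_le tS) => //; exact: ltnW.
have tb (k : 'I_n) : t k.+1 <= b by rewrite -tn; apply: (chain_le tS).
have uv k : u k <= v k by rewrite /u /v; case: ifP => // _; exact: tS.
have vt k : v k <= t k.+1 by rewrite /v; case: ifP => // _; exact: tS.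
have triv := trivIset_chain tS vt.
have /gd : forall k, a <= u k /\ u k <= v k /\ v k <= b.
  by move=> k; split; [exact: ta|split; [exact: uv | exact: le_trans (tb k)]].
move=> /(_ triv) ge.
have {}ge : \sum_(k < n) (g (v k) - g (u k)) < e / 2.
  apply: (@le_lt_trans _ _ (\sum_(k < n) Num.max 0 (g (v k) - g (u k)))).
    by apply: ler_sum => k _; rewrite le_max lexx orbT.
  apply: ge; apply: (sum_itv_le_measure mU Ud) => // k x.
  rewrite /v /u /isbad; case: asboolP => [bk|_].
    rewrite /= in_itv /= => /andP[x1 x2].
    by apply: bk; rewrite /= in_itv /= !ltW.
  by rewrite /= in_itv /= => /andP[x1 x2]; move: (lt_trans x1 x2); rewrite ltxx.
have -> : g b = g a + \sum_(k < n) (g (t k.+1) - g (t k)).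
  rewrite -(big_mkord xpredT (fun k => g (t k.+1) - g (t k))).
  by rewrite telescope_sumr // t0 tn addrC subrK.
rewrite lerD2l.
have le_cell (k : 'I_n) : g (t k.+1) - g (t k) <=
    (g (v k) - g (u k)) + eta * (t k.+1 - t k).
  have [tt [bk|gk]] := tP k (ltn_ord k).
    rewrite /v /u /isbad asboolT // lerDl mulr_ge0 //; first exact: ltW.
    by rewrite subr_ge0.
  rewrite /v /u /isbad; case: asboolP => _; last by rewrite subrr add0r.
  by rewrite lerDl mulr_ge0 ?subr_ge0 // ltW.
apply: le_trans (ler_sum _ (fun k _ => le_cell k)) _.
rewrite big_split /= -mulr_sumr.
rewrite -(big_mkord xpredT (fun k => t k.+1 - t k)) telescope_sumr // t0 tn.
have : eta * (b - a) <= e / 2.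
  rewrite /eta invfM !mulrA -[X in _ <= X]mulr1 -mulrA ler_wpM2l ?ltW //.
  by rewrite mulrC ltr_pdivrMr // mul1r; lra.
lra.
Qed.

Lemma ae_imply (R : realType) (P Q : R -> Prop) :
  (forall s, P s -> Q s) ->
  {ae @lebesgue_measure R, forall s, P s} ->
  {ae @lebesgue_measure R, forall s, Q s}.
Proof.
by move=> PQ; apply: (@filterS _ _ (ae_filter_ringOfSetsType lebesgue_measure)).
Qed.

(** The function s |-> g s * exp (L * (b - s)) has nonpositive upper slope.
    Nonnegativity of g lets 1 + x <= exp x replace the derivative of the
    exponential. *)
Lemma gronwall_le (R : realType) (a b L : R) (g : R -> R) :
  a <= b -> 0 <= L -> (forall s, a <= s -> s <= b -> 0 <= g s) ->
  upper_ac a b g ->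
  {ae @lebesgue_measure R, forall s, a <= s -> s <= b ->
    slope_le a b g s (L * g s)} ->
  g b <= g a * expR (L * (b - a)).
Proof.
move=> ab L0 g0 acg aeg.
pose E s := expR (L * (b - s)).
pose C := E a.
have E0 s : 0 < E s by exact: expR_gt0.
have C0 : 0 < C by exact: E0.
have EC s : a <= s -> E s <= C.
  by move=> sa; rewrite ler_expR ler_wpM2l // lerD2l lerN2.
have EL u v : E v * (1 + L * (v - u)) <= E u.
  have -> : E u = E v * expR (L * (v - u)).
    by rewrite /E -expRD; congr expR; ring.
  by rewrite ler_pM2l // expR_ge1Dx.
have key u v : a <= u -> u <= v -> v <= b ->
    g v * E v - g u * E u <= E v * (g v - g u - L * (v - u) * g u).
  move=> au uv vb.
  have gu : 0 <= g u by apply: g0 => //; lra.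
  have := ler_wpM2l gu (EL u v); nra.
suff : g b * E b <= g a * E a.
  by rewrite /E subrr mulr0 expR0 mulr1.
apply: (@upper_ac_nonincreasing R a b (fun s => g s * E s)) => //.
- move=> e e0; have eC0 : 0 < e / C by exact: divr_gt0.
  have [delta d0 gd] := acg _ eC0; exists delta => // n u v uv triv suv.
  have := gd n u v uv triv suv; rewrite ltr_pdivlMr //; apply: le_lt_trans.
  rewrite mulr_suml; apply: ler_sum => k _.
  have [auk [uvk vbk]] := uv k.
  have gu : 0 <= g (u k) by apply: g0 => //; lra.
  have Mle : g (v k) - g (u k) <= Num.max 0 (g (v k) - g (u k)).
    by rewrite le_max lexx orbT.
  have M0 : 0 <= Num.max 0 (g (v k) - g (u k)) by rewrite le_max lexx.
  rewrite ge_max; apply/andP; split; first by rewrite mulr_ge0 //; exact: ltW.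
  apply: le_trans (key _ _ auk uvk vbk) _.
  have EvC : E (v k) <= C by apply: EC; lra.
  apply: (@le_trans _ _ (E (v k) * Num.max 0 (g (v k) - g (u k)))).
    rewrite ler_pM2l //; apply: le_trans Mle; rewrite gerBl.
    by rewrite !mulr_ge0 // subr_ge0.
  by rewrite mulrC ler_wpM2l.
- apply: ae_imply aeg => s sl sa sb e e0.
  have gs0 : 0 <= g s by exact: g0.
  pose e1 := e / (2 * C).
  have e10 : 0 < e1 by rewrite divr_gt0 // mulr_gt0.
  have [delta d0 gd] := sl sa sb _ e10.
  pose M := L * (L * g s + e1).
  have M0 : 0 <= M by rewrite /M mulr_ge0 // addr_ge0 ?(ltW e10) ?mulr_ge0.
  pose d2 := Num.min delta (e1 / (M + 1)).
  have M1 : 0 < M + 1 by lra.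
  have d20 : 0 < d2 by rewrite lt_min d0 divr_gt0.
  exists d2 => // u v au us sv vb; rewrite lt_min => /andP[uvd uvM].
  have uv : u <= v by lra.
  have vu0 : 0 <= v - u by lra.
  apply: le_trans (key _ _ au uv vb) _.
  have gvu := gd u v au us sv vb uvd.
  (* the slope bound at s also keeps g from dropping below g s on its left *)
  have gsu : g s - g u <= (L * g s + e1) * (v - u).
    have sud : s - u < delta by lra.
    apply: le_trans (gd u s au us (lexx s) sb sud) _.
    by rewrite ler_wpM2l //; [rewrite addr_ge0 ?(ltW e10) ?mulr_ge0 | lra].
  have uvM' : M * (v - u) <= e1.
    move: uvM; rewrite ltr_pdivlMr // => uvM; nra.
  have Lgu : L * (g s - g u) <= M * (v - u).
    by rewrite /M -mulrA; apply: ler_wpM2l.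
  have step : g v - g u - L * (v - u) * g u <= 2 * e1 * (v - u).
    have : (L * (g s - g u)) * (v - u) <= e1 * (v - u).
      by apply: ler_wpM2r => //; lra.
    nra.
  have Ev : E v <= C by apply: EC; lra.
  apply: (@le_trans _ _ (C * (2 * e1 * (v - u)))).
    apply: (@le_trans _ _ (E v * (2 * e1 * (v - u)))); first by rewrite ler_pM2l.
    by apply: ler_wpM2r => //; apply: mulr_ge0 => //; lra.
  have -> : C * (2 * e1 * (v - u)) = e * (v - u).
    by rewrite /e1; field; rewrite gt_eqF.
  by rewrite add0r.
Qed.

(** * Strong derivatives and the l1 norm *)

Lemma l1norm_ge0 (R : realType) (d : nat) (x : 'cV[R]_d) : 0 <= l1norm x.
Proof. exact: sumr_ge0. Qed.

Lemma l1norm0 (R : realType) (d : nat) : l1norm (0 : 'cV[R]_d) = 0.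
Proof. by rewrite /l1norm big1 // => i _; rewrite mxE normr0. Qed.

Lemma l1normN (R : realType) (d : nat) (x : 'cV[R]_d) :
  l1norm (- x) = l1norm x.
Proof. by apply: eq_bigr => i _; rewrite mxE normrN. Qed.

Lemma l1normD (R : realType) (d : nat) (x y : 'cV[R]_d) :
  l1norm (x + y) <= l1norm x + l1norm y.
Proof.
rewrite /l1norm -big_split /=; apply: ler_sum => i _.
by rewrite mxE ler_normD.
Qed.

Lemma l1normZ (R : realType) (d : nat) (a : R) (x : 'cV[R]_d) :
  l1norm (a *: x) = `|a| * l1norm x.
Proof.
by rewrite /l1norm mulr_sumr; apply: eq_bigr => i _; rewrite mxE normrM.
Qed.

Lemma l1normBC (R : realType) (d : nat) (x y : 'cV[R]_d) :
  l1norm (x - y) = l1norm (y - x).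
Proof. by rewrite -l1normN opprB. Qed.

Lemma l1normB (R : realType) (d : nat) (x y : 'cV[R]_d) :
  l1norm (x - y) <= l1norm x + l1norm y.
Proof. by rewrite -(l1normN y) l1normD. Qed.

Lemma l1norm_leB (R : realType) (d : nat) (x y : 'cV[R]_d) :
  l1norm x - l1norm y <= l1norm (x - y).
Proof. by rewrite lerBlDr -{1}(subrK y x) l1normD. Qed.

Lemma l1norm_sum (R : realType) (d : nat) (I : finType) (F : I -> 'cV[R]_d) :
  l1norm (\sum_i F i) <= \sum_i l1norm (F i).
Proof.
apply: (big_ind2 (fun x a => l1norm x <= a)) => //; first by rewrite l1norm0.
by move=> x a y b xa yb; apply: le_trans (l1normD x y) (lerD xa yb).
Qed.

Lemma l1norm_le_norm (R : realType) (d : nat) (x : 'cV[R]_d) :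
  l1norm x <= d%:R * `|x|.
Proof.
rewrite -[X in X%:R]card_ord mulr_natl -sumr_const; apply: ler_sum => i _.
rewrite [X in _ <= X]mx_normrE.
exact: (le_bigmax _ (fun ij => `|x ij.1 ij.2|) (i, ord0)).
Qed.

(** Differentiability at s in the two-sided form of the straddle lemma, without
    any norm of the difference quotient. *)
Definition straddle (R : realType) (d : nat) (f : R -> 'cV[R]_d) (s : R)
    (D : 'cV[R]_d) : Prop :=
  forall e : R, 0 < e -> exists2 delta : R, 0 < delta &
    forall u v, u <= s -> s <= v -> v - u < delta ->
      l1norm (f v - f u - (v - u) *: D) <= e * (v - u).

(** The increments from s to v and from u to s are close to linear, and their
    errors add up because (v - s) + (s - u) = v - u. *)
Lemma is_derive_straddle (R : realType) (d : nat) (f : R -> 'cV[R]_d) (s : R)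
    (D : 'cV[R]_d) : is_derive s 1 f D -> straddle f s D.
Proof.
move=> [df fD] e e0.
have cf : (fun h => h^-1 *: ((f \o shift s) (h *: (1 : R)) - f s)) @ 0^' --> D.
  by rewrite -fD; exact: df.
(* the derivative is a limit for the sup norm, whence the factor d *)
pose e1 := e / (d%:R + 1).
have d1 : 0 < d%:R + 1 :> R by rewrite ltr_wpDl.
have e10 : 0 < e1 by exact: divr_gt0.
have /= := cvgr_distC_le _ _ cf _ e10.
move=> [r /= r0 rf].
have incr h : `|h| < r -> l1norm (f (s + h) - f s - h *: D) <= e * `|h|.
  move=> hr; have [->|h0] := eqVneq h 0.
    by rewrite addr0 subrr sub0r scale0r oppr0 l1norm0 normr0 mulr0.
  have := rf h; rewrite /ball /= sub0r normrN => /(_ hr h0).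
  rewrite /= scaler1 [h + s]addrC => hD.
  have -> : f (s + h) - f s - h *: D = h *: (h^-1 *: (f (s + h) - f s) - D).
    by rewrite scalerBr scalerA mulfV // scale1r.
  rewrite l1normZ mulrC ler_wpM2r //.
  apply: le_trans (l1norm_le_norm _) _.
  apply: (@le_trans _ _ (d%:R * e1)); first by rewrite ler_wpM2l.
  rewrite /e1 mulrC -mulrA ler_piMr //; first exact: ltW.
  by rewrite mulrC ler_pdivrMr // mul1r lerDl.
exists r => // u v us sv vur.
have hv : `|v - s| < r by rewrite ger0_norm; lra.
have hu : `|u - s| < r by rewrite ler0_norm; lra.
have := incr _ hv; have := incr _ hu.
rewrite ![s + (_ - s)]addrC !subrK (ger0_norm (_ : 0 <= v - s)); last by lra.
rewrite (ler0_norm (_ : u - s <= 0)); last by lra.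
move=> fu fv.
have -> : f v - f u - (v - u) *: D =
   (f v - f s - (v - s) *: D) - (f u - f s - (u - s) *: D).
  by apply/matrixP => i j; rewrite !mxE; ring.
apply: le_trans (l1normB _ _) _; lra.
Qed.

Lemma straddleB (R : realType) (d : nat) (f g : R -> 'cV[R]_d) (s : R)
    (Df Dg : 'cV[R]_d) : straddle f s Df -> straddle g s Dg ->
  straddle (fun x => f x - g x) s (Df - Dg).
Proof.
move=> sf sg e e0; have e20 : 0 < e / 2 by lra.
have [df df0 Hf] := sf _ e20; have [dg dg0 Hg] := sg _ e20.
exists (Num.min df dg); first by rewrite lt_min df0.
move=> u v us sv; rewrite lt_min => /andP[uvf uvg].
have -> : f v - g v - (f u - g u) - (v - u) *: (Df - Dg) =
   (f v - f u - (v - u) *: Df) - (g v - g u - (v - u) *: Dg).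
  by apply/matrixP => i j; rewrite !mxE; ring.
have := Hf u v us sv uvf; have := Hg u v us sv uvg.
have := l1normB (f v - f u - (v - u) *: Df) (g v - g u - (v - u) *: Dg); lra.
Qed.

Lemma straddle_locally_affine (R : realType) (d : nat) (f : R -> 'cV[R]_d)
    (s l r : R) (D : 'cV[R]_d) : l < s -> s < r ->
  (forall u v, l <= u -> u <= v -> v <= r -> f v - f u = (v - u) *: D) ->
  straddle f s D.
Proof.
move=> ls sr fD e e0; exists (Num.min (s - l) (r - s)).
  by rewrite lt_min; apply/andP; split; lra.
move=> u v us sv; rewrite lt_min => /andP[ul vr].
rewrite fD ?subrr ?l1norm0; [|lra..].
by apply: mulr_ge0; lra.
Qed.

Lemma slope_le_l1norm (R : realType) (d : nat) (f : R -> 'cV[R]_d) (a b s : R)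
    (D : 'cV[R]_d) : straddle f s D ->
  slope_le a b (fun x => l1norm (f x)) s (l1norm D).
Proof.
move=> sf e e0; have [delta d0 Hf] := sf _ e0; exists delta => // u v _ us sv _ uv.
have H := Hf u v us sv uv.
apply: le_trans (l1norm_leB _ _) _.
rewrite -(subrK ((v - u) *: D) (f v - f u)).
apply: le_trans (l1normD _ _) _; rewrite l1normZ ger0_norm; last by lra.
by rewrite mulrDl; lra.
Qed.

Lemma slope_leD (R : realType) (a b s k l : R) (f g : R -> R) :
  slope_le a b f s k -> slope_le a b g s l ->
  slope_le a b (fun x => f x + g x) s (k + l).
Proof.
move=> sf sg e e0; have e20 : 0 < e / 2 by lra.
have [df df0 Hf] := sf _ e20; have [dg dg0 Hg] := sg _ e20.
exists (Num.min df dg); first by rewrite lt_min df0.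
move=> u v au us sv vb; rewrite lt_min => /andP[uvf uvg].
have := Hf u v au us sv vb uvf; have := Hg u v au us sv vb uvg; nra.
Qed.

Lemma slope_leW (R : realType) (a b s k l : R) (f : R -> R) :
  k <= l -> slope_le a b f s k -> slope_le a b f s l.
Proof.
move=> kl sf e e0; have [df df0 Hf] := sf _ e0; exists df => // u v au us sv vb uv.
by apply: le_trans (Hf u v au us sv vb uv) _; rewrite ler_wpM2r //; lra.
Qed.

Lemma slope_le_affine (R : realType) (a b s k c : R) :
  slope_le a b (fun x => c + k * x) s k.
Proof.
move=> e e0; exists 1 => // u v _ us sv _ _.
have : 0 <= e * (v - u) by apply: mulr_ge0; lra.
lra.
Qed.

Lemma ac_sub (R : realType) (d : nat) (a b a' b' : R) (f : R -> 'cV[R]_d) :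
  a <= a' -> b' <= b ->
  absolutely_continuous_on a b f -> absolutely_continuous_on a' b' f.
Proof.
move=> aa bb acf e e0; have [delta d0 Hf] := acf _ e0; exists delta => // n u v uv.
by apply: Hf => k; have [? [? ?]] := uv k; split; [lra | split; lra].
Qed.

Lemma acB (R : realType) (d : nat) (a b : R) (f g : R -> 'cV[R]_d) :
  absolutely_continuous_on a b f -> absolutely_continuous_on a b g ->
  absolutely_continuous_on a b (fun x => f x - g x).
Proof.
move=> acf acg e e0; have e20 : 0 < e / 2 by lra.
have [df df0 Hf] := acf _ e20; have [dg dg0 Hg] := acg _ e20.
exists (Num.min df dg); first by rewrite lt_min df0.
move=> n u v uv triv; rewrite lt_min => /andP[uvf uvg].
have := Hf n u v uv triv uvf; have := Hg n u v uv triv uvg => H1 H2.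
rewrite (splitr e); apply: le_lt_trans (ltrD H2 H1).
rewrite -big_split /=; apply: ler_sum => k _.
apply: le_trans (l1normB _ _); rewrite le_eqVlt; apply/orP; left; apply/eqP.
by congr l1norm; apply/matrixP => i j; rewrite !mxE; ring.
Qed.

Lemma lipschitz_ac (R : realType) (d : nat) (a b C : R) (f : R -> 'cV[R]_d) :
  (forall u v, u <= v -> l1norm (f v - f u) <= C * (v - u)) ->
  absolutely_continuous_on a b f.
Proof.
move=> lf e e0; pose C1 := `|C| + 1.
have C10 : 0 < C1 by rewrite /C1 ltr_wpDl.
exists (e / C1); first exact: divr_gt0.
move=> n u v uv _; rewrite ltr_pdivlMr // mulrC; apply: le_lt_trans.
rewrite mulr_sumr; apply: ler_sum => k _; have [_ [uvk _]] := uv k.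
apply: le_trans (lf _ _ uvk) _; rewrite ler_wpM2r ?subr_ge0 //.
by rewrite /C1; have := ler_norm C; lra.
Qed.

(** The functions that are compared below have this shape: a norm plus an error
    budget that is still to be spent. *)
Lemma upper_ac_l1normD (R : realType) (d : nat) (a b : R) (f : R -> 'cV[R]_d)
    (g : R -> R) :
  absolutely_continuous_on a b f -> (forall u v, u <= v -> g v <= g u) ->
  upper_ac a b (fun x => l1norm (f x) + g x).
Proof.
move=> acf gN e e0; have [delta d0 Hf] := acf _ e0; exists delta => // n u v uv triv.
move=> suv; apply: le_lt_trans (Hf n u v uv triv suv); apply: ler_sum => k _.
have [_ [uvk _]] := uv k.
rewrite ge_max l1norm_ge0 /=; have := l1norm_leB (f (v k)) (f (u k)).
have := gN _ _ uvk; lra.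
Qed.

(** The function x |-> x * |x| is a primitive of 2 * |x|, the cost of freezing a
    Lipschitz curve at mid. *)
Lemma slope_le_signed_square (R : realType) (a b s mid C : R) : 0 <= C ->
  slope_le a b (fun x => - (C * ((x - mid) * `|x - mid|))) s
    (- (C * (2 * `|s - mid|))).
Proof.
move=> C0 e e0.
have C1 : 0 < C + 1 by lra.
exists (e / (2 * (C + 1))); first by rewrite divr_gt0 // mulr_gt0.
move=> u v _ us sv _; rewrite ltr_pdivlMr; last by rewrite mulr_gt0.
move=> uvd.
have uv0 : 0 <= v - u by lra.
have Ce : C * (2 * (v - u)) <= e by nra.
suff key : (2 * `|s - mid| - 2 * (v - u)) * (v - u) <=
    (v - mid) * `|v - mid| - (u - mid) * `|u - mid|.
  have := ler_wpM2l C0 key.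
  have : C * (2 * (v - u)) * (v - u) <= e * (v - u) by rewrite ler_wpM2r.
  lra.
have [um|um] := leP 0 (u - mid).
  rewrite (ger0_norm um) !ger0_norm; [|lra..]; nra.
have [vm|vm] := leP (v - mid) 0.
  rewrite (ler0_norm vm) !ler0_norm; [|lra..]; nra.
rewrite (ltr0_norm um) (gtr0_norm vm).
have smuv : `|s - mid| <= v - u by rewrite ler_norml; apply/andP; split; lra.
nra.
Qed.

Lemma signed_square_le (R : realType) (mid u v : R) : u <= v ->
  (u - mid) * `|u - mid| <= (v - mid) * `|v - mid|.
Proof.
move=> uv; have [um|um] := leP 0 (u - mid).
  rewrite (ger0_norm um) ger0_norm; [nra|lra].
have [vm|vm] := leP (v - mid) 0.
  rewrite (ler0_norm vm) ler0_norm; [nra|lra].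
rewrite (ltr0_norm um) (gtr0_norm vm); nra.
Qed.

(** * Operator norms and a priori bounds *)

Lemma l1norm_mulmx_entries (R : realType) (d : nat) (A : 'M[R]_d)
    (x : 'cV[R]_d) :
  l1norm (A *m x) <= (\sum_i \sum_j `|A i j|) * l1norm x.
Proof.
rewrite mulr_suml; apply: ler_sum => i _; rewrite mxE.
apply: le_trans (ler_norm_sum _ _ _) _; rewrite mulr_suml.
apply: ler_sum => j _; rewrite normrM ler_wpM2l //.
by rewrite /l1norm (bigD1 j) //= lerDl sumr_ge0.
Qed.

(** The entrywise bound makes the set of values bounded, so that its supremum is
    an upper bound. *)
Lemma l1opnorm_bounded (R : realType) (d : nat) (A : 'M[R]_d)
    (x : 'cV[R]_d) : l1norm x <= 1 -> l1norm (A *m x) <= l1opnorm A.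
Proof.
move=> x1; apply: ub_le_sup; last by exists x.
exists (\sum_i \sum_j `|A i j|) => _ [y /= y1 <-].
apply: le_trans (l1norm_mulmx_entries _ _) _.
by rewrite ler_piMr // sumr_ge0 // => i _; exact: sumr_ge0.
Qed.

Lemma l1opnorm_ge0 (R : realType) (d : nat) (A : 'M[R]_d) : 0 <= l1opnorm A.
Proof.
by rewrite -(l1norm0 R d) -(mulmx0 _ A) l1opnorm_bounded // l1norm0.
Qed.

Lemma l1norm_mulmx (R : realType) (d : nat) (A : 'M[R]_d) (x : 'cV[R]_d) :
  l1norm (A *m x) <= l1opnorm A * l1norm x.
Proof.
have [x0|x0] := eqVneq (l1norm x) 0.
  by have := l1norm_mulmx_entries A x; rewrite x0 !mulr0.
have xp : 0 < l1norm x by rewrite lt_def x0 l1norm_ge0.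
have := @l1opnorm_bounded _ _ A ((l1norm x)^-1 *: x).
rewrite -scalemxAr !l1normZ ger0_norm ?invr_ge0 ?l1norm_ge0 // mulVf //.
by move=> /(_ (lexx _)); rewrite mulrC ler_pdivrMr.
Qed.

Lemma le_sup_range (R : realType) (m : nat) (F : 'I_m -> R) (i : 'I_m) :
  F i <= sup (range F).
Proof.
apply: ub_le_sup; last by exists i.
exists (\sum_j `|F j|) => _ [j _ <-]; apply: le_trans (ler_norm _) _.
by rewrite (bigD1 j) //= lerDl sumr_ge0.
Qed.

Lemma sum_le_of_scaled_le (R : realType) (m : nat) (F : 'I_m -> R) (B : R) :
  (0 < m)%N -> (forall i, m%:R * F i <= B) -> \sum_i F i <= B.
Proof.
move=> m0 FB; have mR : 0 < m%:R :> R by rewrite ltr0n.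
rewrite -(ler_pM2l mR) mulr_sumr; apply: le_trans (ler_sum _ (fun i _ => FB i)) _.
by rewrite sumr_const card_ord mulr_natl.
Qed.

Lemma layer_lipschitz (R : realType) (d : nat) (sigma : R -> R) (K : R)
    (A W : 'M[R]_d) (b x y : 'cV[R]_d) :
  (forall u v : R, `|sigma u - sigma v| <= K * `|u - v|) ->
  l1norm (layer sigma A W b x - layer sigma A W b y) <=
  K * l1opnorm A * l1opnorm W * l1norm (x - y).
Proof.
move=> lips.
have lipS u v : l1norm (Sigma sigma u - Sigma sigma v) <= K * l1norm (u - v :> 'cV[R]_d).
  rewrite mulr_sumr; apply: ler_sum => i _.
  by rewrite !mxE; exact: lips.
have K0 : 0 <= K.
  by have := lips 1 0; rewrite subr0 normr1 mulr1; exact: le_trans.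
rewrite /layer -mulmxBr; apply: le_trans (l1norm_mulmx _ _) _.
rewrite [K * _]mulrC -!mulrA ler_wpM2l ?l1opnorm_ge0 //.
apply: le_trans (lipS _ _) _; rewrite ler_wpM2l //.
by rewrite opprD addrACA subrr addr0 -mulmxBr l1norm_mulmx.
Qed.

(** Gronwall's inequality for |f s| + c * (t - s): the affine term compensates
    the constant part of the growth, so that the homogeneous form is enough. *)
Lemma growth_bound (R : realType) (d : nat) (c L t : R) (f : R -> 'cV[R]_d) :
  0 <= c -> 0 <= L -> 0 <= t -> absolutely_continuous_on 0 t f ->
  {ae @lebesgue_measure R, forall s, 0 <= s -> s <= t ->
     exists2 D, straddle f s D & l1norm D <= c + L * l1norm (f s)} ->
  l1norm (f t) <= (l1norm (f 0) + c * t) * expR (L * t).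
Proof.
move=> c0 L0 t0 acf aef.
have := @gronwall_le R 0 t L (fun s => l1norm (f s) + (c * t + - c * s)).
rewrite mulr0 addr0 mulNr subrr addr0 subr0; apply => //.
- by move=> s s0 st; have := l1norm_ge0 (f s); nra.
- by apply: upper_ac_l1normD => // u v uv; nra.
apply: ae_imply aef => s H s0 st; have [D sD Dle] := H s0 st.
apply: slope_leW (slope_leD (slope_le_l1norm 0 t sD) (slope_le_affine _ _ _ (- c) _)).
have : 0 <= L * (c * t - c * s) by apply: mulr_ge0 => //; nra.
lra.
Qed.

Lemma increment_bound (R : realType) (d : nat) (a b X : R)
    (f : R -> 'cV[R]_d) :
  a <= b -> 0 <= X -> absolutely_continuous_on a b f ->
  {ae @lebesgue_measure R, forall s, a <= s -> s <= b ->
     exists2 D, straddle f s D & l1norm D <= X} ->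
  l1norm (f b - f a) <= X * (b - a).
Proof.
move=> ab X0 acf aef.
have acc : absolutely_continuous_on a b (fun=> f a).
  by apply: (@lipschitz_ac _ _ _ _ 0) => u v _; rewrite subrr l1norm0 mul0r.
have /= := @upper_ac_nonincreasing R a b
  (fun s => l1norm (f s - f a) + (0 + - X * s)).
rewrite subrr l1norm0 => H; suff : l1norm (f b - f a) + (0 + - X * b) <=
  0 + (0 + - X * a) by lra.
apply: H => //.
- apply: upper_ac_l1normD (acB acf acc) _ => u v uv; nra.
apply: ae_imply aef => s H s0 st; have [D sD Dle] := H s0 st.
have sc : straddle (fun=> f a) s 0.
  apply: (@straddle_locally_affine _ _ _ _ (s - 1) (s + 1)); [lra|lra|].
  by move=> u v _ _ _; rewrite subrr scaler0.
apply: slope_leW (slope_leD (slope_le_l1norm _ _ (straddleB sD sc))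
  (slope_le_affine _ _ _ _ _)).
by rewrite subr0; lra.
Qed.

(** * One period *)

(** For w >= 0, the primitive of the indicator function of the slot [l, l + w]
    that vanishes at l. *)
Definition ramp (R : realType) (w l s : R) : R :=
  Num.min (Num.max 0 (s - l)) w.

Section Ramp.
Variables (R : realType) (w l : R).
Hypothesis w0 : 0 <= w.

Lemma ramp_ge0 s : 0 <= ramp w l s.
Proof. by rewrite /ramp le_min w0 le_max lexx. Qed.

Lemma ramp_le s : ramp w l s <= w.
Proof. by rewrite /ramp ge_min lexx orbT. Qed.

Lemma ramp_before s : s <= l -> ramp w l s = 0.
Proof. by move=> sl; rewrite /ramp max_l ?min_l // subr_le0. Qed.

Lemma ramp_after s : l + w <= s -> ramp w l s = w.
Proof. by move=> sl; rewrite /ramp min_r // le_max; apply/orP; right; lra. Qed.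

Lemma ramp_inside s : l <= s -> s <= l + w -> ramp w l s = s - l.
Proof. by move=> ls sw; rewrite /ramp max_r ?min_l //; lra. Qed.

Lemma ramp_lipschitz u v : u <= v -> `|ramp w l v - ramp w l u| <= v - u.
Proof.
move=> uv; have [ul|ul] := leP u l; have [vl|vl] := leP v (l + w).
- rewrite (ramp_before ul) subr0; have [vl'|vl'] := leP v l.
    by rewrite (ramp_before vl') normr0; lra.
  by rewrite ramp_inside // ?(ltW vl') // ger0_norm; lra.
- by rewrite (ramp_before ul) ramp_after ?(ltW vl) // subr0 ger0_norm //; lra.
- rewrite !ramp_inside; [|lra..].
  by rewrite ger0_norm; lra.
- rewrite (ramp_after (ltW vl)); have [ul'|ul'] := leP u (l + w).
    by rewrite ramp_inside // ?(ltW ul) // ger0_norm; lra.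
  by rewrite ramp_after ?(ltW ul') // subrr normr0; lra.
Qed.

End Ramp.

(** The primitive of s |-> Q_s - Q~ on the period [a, a + h], where the i-th
    field has the frozen value w i: during slot i the field Q_s is m * w i. *)
Definition corrector (R : realType) (d m : nat) (a h : R) (w : 'I_m -> 'cV[R]_d)
    (s : R) : 'cV[R]_d :=
  \sum_(i < m) (m%:R * ramp (h / m%:R) (a + i%:R * (h / m%:R)) s) *: w i
  - (s - a) *: \sum_i w i.

Section Corrector.
Variables (R : realType) (d m : nat) (a h : R) (w : 'I_m -> 'cV[R]_d).
Hypotheses (m0 : (0 < m)%N) (h0 : 0 < h).

Let mR : 0 < m%:R :> R. Proof. by rewrite ltr0n. Qed.
Let hm0 : 0 < h / m%:R. Proof. exact: divr_gt0. Qed.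

Lemma corrector_start : corrector a h w a = 0.
Proof.
rewrite /corrector subrr scale0r subr0 big1 // => i _.
rewrite ramp_before ?mulr0 ?scale0r //; first exact: ltW.
by rewrite lerDl mulr_ge0 // ltW.
Qed.

Lemma corrector_end : corrector a h w (a + h) = 0.
Proof.
rewrite /corrector addrAC subrr add0r scaler_sumr -sumrB big1 // => i _.
rewrite ramp_after ?(ltW hm0) //; last first.
  have : (i.+1)%:R * (h / m%:R) <= m%:R * (h / m%:R).
    by rewrite ler_wpM2r ?(ltW hm0) // ler_nat.
  have -> : m%:R * (h / m%:R) = h by field; rewrite gt_eqF.
  by rewrite -natr1 mulrDl mul1r; lra.
by have -> : m%:R * (h / m%:R) = h by [field; rewrite gt_eqF]; rewrite subrr.
Qed.

(** Each of the two primitives is at most h * X: the total time spent in all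
    slots and the time elapsed since a are at most h. *)
Lemma corrector_bound X s : a <= s -> s <= a + h ->
  (forall i, m%:R * l1norm (w i) <= X) ->
  l1norm (corrector a h w s) <= 2 * h * X.
Proof.
move=> sa sh wX.
have wX1 : l1norm (\sum_i w i) <= X.
  by apply: le_trans (l1norm_sum _) _; exact: sum_le_of_scaled_le.
have wX2 : l1norm (\sum_(i < m)
    (m%:R * ramp (h / m%:R) (a + i%:R * (h / m%:R)) s) *: w i) <= h * X.
  apply: le_trans (l1norm_sum _) _; apply: sum_le_of_scaled_le => // i.
  rewrite l1normZ ger0_norm; last by rewrite mulr_ge0 ?ramp_ge0 ?ltW.
  have -> : m%:R * (m%:R * ramp (h / m%:R) (a + i%:R * (h / m%:R)) s * l1norm (w i))
    = (m%:R * ramp (h / m%:R) (a + i%:R * (h / m%:R)) s) * (m%:R * l1norm (w i)).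
    by ring.
  apply: ler_pM => //.
  - by rewrite mulr_ge0 ?ramp_ge0 ?ltW.
  - by rewrite mulr_ge0 ?l1norm_ge0 ?ltW.
  apply: (@le_trans _ _ (m%:R * (h / m%:R))); first by rewrite ler_pM2l // ramp_le.
  by rewrite mulrCA mulfV ?mulr1 // gt_eqF.
apply: le_trans (l1normB _ _) _; rewrite l1normZ ger0_norm; last by lra.
have X0 : 0 <= X by apply: le_trans wX1; exact: l1norm_ge0.
have : (s - a) * l1norm (\sum_i w i) <= h * X.
  by apply: ler_pM => //; [lra|exact: l1norm_ge0|lra].
lra.
Qed.

Lemma corrector_increment u v : corrector a h w v - corrector a h w u =
  \sum_(i < m) (m%:R * (ramp (h / m%:R) (a + i%:R * (h / m%:R)) v -
                  ramp (h / m%:R) (a + i%:R * (h / m%:R)) u)) *: w i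
  - (v - u) *: \sum_i w i.
Proof.
have E (x y z t : 'cV[R]_d) : (x - y) - (z - t) = (x - z) - (y - t).
  by rewrite !opprB addrACA [RHS]addrACA; congr (_ + _); rewrite addrC.
rewrite /corrector E -sumrB -scalerBl; congr (_ - _ *: _); last by ring.
by apply: eq_bigr => i _; rewrite -scalerBl mulrBr.
Qed.

Lemma corrector_slot (i : 'I_m) u v :
  a + i%:R * (h / m%:R) <= u -> u <= v -> v <= a + i.+1%:R * (h / m%:R) ->
  corrector a h w v - corrector a h w u =
  (v - u) *: (m%:R *: w i - \sum_j w j).
Proof.
move=> iu uv vi; rewrite corrector_increment scalerBr; congr (_ - _).
rewrite (bigD1 i) //= big1 => [|j ji].
  move: vi; rewrite -natr1 => vi.
  rewrite !ramp_inside ?(ltW hm0) ?addr0 ?scalerA //; [|lra..].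
  by congr (_ *: _); ring.
have [lij|lij|eij] := ltngtP i j; last by rewrite (val_inj eij) eqxx in ji.
  have lR : i.+1%:R * (h / m%:R) <= j%:R * (h / m%:R).
    by rewrite ler_wpM2r ?(ltW hm0) // ler_nat.
  by rewrite !ramp_before ?(ltW hm0) ?subrr ?mulr0 ?scale0r //; lra.
have lR : j.+1%:R * (h / m%:R) <= i%:R * (h / m%:R).
  by rewrite ler_wpM2r ?(ltW hm0) // ler_nat.
move: lR; rewrite -natr1 => lR.
by rewrite !ramp_after ?(ltW hm0) ?subrr ?mulr0 ?scale0r //; lra.
Qed.

Lemma corrector_lipschitz u v : u <= v ->
  l1norm (corrector a h w v - corrector a h w u) <=
  (\sum_i m%:R * l1norm (w i) + l1norm (\sum_i w i)) * (v - u).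
Proof.
move=> uv; rewrite corrector_increment; apply: le_trans (l1normB _ _) _.
rewrite mulrDl lerD //; last by rewrite l1normZ ger0_norm ?subr_ge0 // mulrC.
apply: le_trans (l1norm_sum _) _; rewrite mulr_suml; apply: ler_sum => i _.
rewrite l1normZ normrM ger0_norm ?ler0n // -!mulrA ler_pM2l // mulrC.
by rewrite ler_wpM2l ?l1norm_ge0 // ramp_lipschitz // ltW.
Qed.

End Corrector.

(** Gronwall's inequality for
      G s = |z s - y s - E s| + 2 h X + (the part of L X h^2 / 2 not yet spent),
    where E is the corrector frozen at the middle of the period, or at t if the
    interval stops earlier.  The slope of the norm is at most
    L |z - y| + 2 L X |s - mid|; the unspent part decreases at the rate
    2 L X |s - mid|, and |z - y| is at most |z - y - E| + 2 h X.  At the end of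
    a full period E vanishes, so that the constant 2 h X is recovered for the
    next period. *)
Lemma averaging_step (R : realType) (d m : nat) (a h t L X : R)
    (q : 'I_m -> 'cV[R]_d -> 'cV[R]_d) (z y : R -> 'cV[R]_d) :
  (0 < m)%N -> 0 < h -> 0 <= L -> 0 <= X -> a <= t -> t <= a + h ->
  (forall i x x', m%:R * l1norm (q i x - q i x') <= L * l1norm (x - x')) ->
  (forall s i, a <= s -> s <= t -> m%:R * l1norm (q i (y s)) <= X) ->
  (forall u v, a <= u -> u <= v -> v <= t ->
     l1norm (y v - y u) <= X * (v - u)) ->
  absolutely_continuous_on a t z -> absolutely_continuous_on a t y ->
  {ae @lebesgue_measure R, forall s, a <= s -> s <= t ->
     straddle y s (\sum_i q i (y s)) /\
     exists i : 'I_m, [/\ a + i%:R * (h / m%:R) < s,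
       s < a + i.+1%:R * (h / m%:R) & straddle z s (m%:R *: q i (z s))]} ->
  let B := (l1norm (z a - y a) + 2 * h * X + L * X * (h ^+ 2 / 2))
           * expR (L * (t - a)) in
  l1norm (z t - y t) <= B /\
  (t = a + h -> l1norm (z t - y t) + 2 * h * X <= B).
Proof.
move=> m0 h0 L0 X0 at_ th qlip qX yX acz acy aezy B.
pose mid := a + h / 2.
pose p := Num.min mid t.
have pt : p <= t by rewrite /p ge_min lexx orbT.
have ap : a <= p by rewrite /p le_min at_ andbT /mid; lra.
have sp s : s <= t -> `|s - p| <= `|s - mid|.
  move=> st; rewrite /p; have [//|tm] := leP mid t.
  by rewrite !ler0_norm; lra.
have yp s : a <= s -> s <= t -> l1norm (y s - y p) <= X * `|s - mid|.
  move=> sa st; apply: (@le_trans _ _ (X * `|s - p|)); last first.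
    by rewrite ler_wpM2l // sp.
  have [lsp|lsp] := leP s p.
    by rewrite l1normBC ler0_norm ?opprB; [apply: yX|rewrite subr_le0].
  by rewrite ger0_norm ?subr_ge0 ?(ltW lsp) //; apply: yX => //; exact: ltW.
pose w i := q i (y p).
pose E := corrector a h w.
have EX s : a <= s -> s <= t -> l1norm (E s) <= 2 * h * X.
  by move=> sa st; apply: corrector_bound => //; [lra|move=> i; exact: qX].
pose C := L * X.
have C0 : 0 <= C by exact: mulr_ge0.
pose F s := (s - mid) * `|s - mid|.
have FE : F (a + h) = h ^+ 2 / 4.
  by rewrite /F /mid ger0_norm; [field|lra].
have FS : F a = - (h ^+ 2 / 4).
  by rewrite /F /mid ler0_norm; [field|lra].
have Fle s : s <= a + h -> F s <= h ^+ 2 / 4.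
  by move=> sh; rewrite -FE; exact: signed_square_le.
pose f s := (z s - y s) - E s.
pose G s := l1norm (f s) + (2 * h * X + C * (h ^+ 2 / 4) + - (C * F s)).
have acf : absolutely_continuous_on a t f.
  apply: acB; first exact: acB.
  by apply: lipschitz_ac => u v uv; exact: corrector_lipschitz.
have hX0 : 0 <= 2 * h * X by rewrite !mulr_ge0 // ltW.
have Gf s : s <= t -> l1norm (f s) + 2 * h * X <= G s.
  move=> st; have : C * F s <= C * (h ^+ 2 / 4).
    by rewrite ler_wpM2l // Fle //; lra.
  rewrite /G; lra.
have G0 s : s <= t -> 0 <= G s.
  by move=> st; have := Gf s st; have := l1norm_ge0 (f s); lra.
have acG : upper_ac a t G.
  apply: upper_ac_l1normD => // u v uv; rewrite lerD2l lerN2 ler_wpM2l //.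
  exact: signed_square_le.
have slG : {ae @lebesgue_measure R, forall s, a <= s -> s <= t ->
    slope_le a t G s (L * G s)}.
  apply: ae_imply aezy => s H sa st; have [sy [i [li ri sz]]] := H sa st.
  have sE : straddle E s (m%:R *: w i - \sum_j w j).
    apply: (straddle_locally_affine li ri) => u v; exact: corrector_slot.
  have sF := slope_le_signed_square a t s mid C0.
  have sc := slope_le_affine a t s 0 (2 * h * X + C * (h ^+ 2 / 4)).
  have := slope_leD (slope_le_l1norm a t (straddleB (straddleB sz sy) sE))
    (slope_leD sc sF).
  rewrite (_ : (fun x => _) = G); last first.
    by apply/funext => x; rewrite /G mul0r addr0.
  apply: slope_leW; apply: (@le_trans _ _ (L * (l1norm (f s) + 2 * h * X))); last first.
    by rewrite ler_wpM2l // Gf.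
  have -> : m%:R *: q i (z s) - \sum_j q j (y s) - (m%:R *: w i - \sum_j w j) =
     m%:R *: (q i (z s) - q i (y s)) + (m%:R *: (q i (y s) - w i)
       - \sum_j (q j (y s) - w j)).
    rewrite sumrB !scalerBr; apply/matrixP => k l; rewrite !mxE; ring.
  have mZ (x : 'cV[R]_d) : l1norm (m%:R *: x) = m%:R * l1norm x.
    by rewrite l1normZ ger0_norm // ler0n.
  (* both m * q i and the sum of the q j are L-Lipschitz: the freezing error is
     twice L |y s - y p| *)
  have e1 := l1normD (m%:R *: (q i (z s) - q i (y s)))
     (m%:R *: (q i (y s) - w i) - \sum_j (q j (y s) - w j)).
  have e2 := l1normB (m%:R *: (q i (y s) - w i)) (\sum_j (q j (y s) - w j)).
  have e3 : l1norm (\sum_j (q j (y s) - w j)) <= L * l1norm (y s - y p).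
    apply: le_trans (l1norm_sum _) _; apply: sum_le_of_scaled_le => // j.
    exact: qlip.
  have e4 := qlip i (y s) (y p); have e5 := qlip i (z s) (y s).
  rewrite !mZ in e1 e2.
  have e6 : L * l1norm (y s - y p) <= C * `|s - mid|.
    by rewrite /C -mulrA; apply: ler_wpM2l => //; exact: yp.
  have e7 : L * l1norm (z s - y s) <= L * (l1norm (f s) + 2 * h * X).
    apply: ler_wpM2l => //; have := l1norm_leB (z s - y s) (E s).
    by have := EX s sa st; rewrite /f; lra.
  rewrite /w in e1 e2 e3 e4 *; lra.
have := gronwall_le at_ L0 (fun s _ => G0 s) acG slG.
have -> : G a * expR (L * (t - a)) = B.
  rewrite /B /G /f FS /E corrector_start // subr0 /C; congr (_ * _); lra.
move=> GB; have Gt := Gf t (lexx t); split.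
  have := l1norm_leB (z t - y t) (E t); have := EX t at_ (lexx t).
  by rewrite -/(f t); lra.
move=> teq; have Et : E t = 0 by rewrite /E teq corrector_end.
by move: Gt; rewrite /f Et subr0; lra.
Qed.

(** * Chaining the periods *)

Lemma ae_notin_countable (R : realType) (A : set R) :
  countable A -> {ae @lebesgue_measure R, forall s, ~ A s}.
Proof.
move=> cA; exists A; split.
- exact: countable_measurable.
- exact: countable_lebesgue_measure0.
- by move=> s /= /contrapT.
Qed.

Lemma slot_exists (R : realType) (m : nat) (a h s : R) :
  (0 < m)%N -> 0 < h -> a <= s -> s < a + h ->
  exists i : 'I_m, a + i%:R * (h / m%:R) <= s < a + i.+1%:R * (h / m%:R).
Proof.
move=> m0 h0 sa sh; have mR : 0 < m%:R :> R by rewrite ltr0n.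
have hm0 : 0 < h / m%:R by exact: divr_gt0.
pose x := (s - a) / (h / m%:R).
have /andP[jx xj] : (Num.truncn x)%:R <= x < (Num.truncn x).+1%:R.
  by rewrite truncn_itv // divr_ge0 ?subr_ge0 // ltW.
have jm : (Num.truncn x < m)%N.
  rewrite -(ltr_nat R); apply: le_lt_trans jx _; rewrite ltr_pdivrMr //.
  by rewrite mulrCA mulfV ?mulr1 ?gt_eqF //; lra.
exists (Ordinal jm) => /=.
by move: jx xj; rewrite ler_pdivlMr // ltr_pdivrMr //; lra.
Qed.

(** By induction |z - y| + 2 h X <= (2 h X + k B) exp (L k h) at time k h, where
    B = L X h^2 / 2; the last period may be incomplete. *)
Lemma averaging_bound (R : realType) (d m N : nat) (h t L X : R)
    (q : 'I_m -> 'cV[R]_d -> 'cV[R]_d) (z y : R -> 'cV[R]_d) :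
  (0 < m)%N -> 0 < h -> 0 <= L -> 0 <= X -> 0 <= t -> t <= N%:R * h ->
  (forall i x x', m%:R * l1norm (q i x - q i x') <= L * l1norm (x - x')) ->
  (forall s i, 0 <= s -> s <= t -> m%:R * l1norm (q i (y s)) <= X) ->
  (forall u v, 0 <= u -> u <= v -> v <= t ->
     l1norm (y v - y u) <= X * (v - u)) ->
  absolutely_continuous_on 0 t z -> absolutely_continuous_on 0 t y ->
  z 0 = y 0 ->
  {ae @lebesgue_measure R, forall s, 0 <= s -> s <= t ->
     straddle y s (\sum_i q i (y s)) /\
     forall k : nat, k%:R * h <= s -> s <= k%:R * h + h ->
     exists i : 'I_m, [/\ k%:R * h + i%:R * (h / m%:R) < s,
       s < k%:R * h + i.+1%:R * (h / m%:R) &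
       straddle z s (m%:R *: q i (z s))]} ->
  l1norm (z t - y t) <=
    (2 * h * X + N%:R * (L * X * (h ^+ 2 / 2))) * expR (L * t).
Proof.
move=> m0 h0 L0 X0 t0 tN qlip qX yX acz acy zy0 aezy.
pose B := L * X * (h ^+ 2 / 2).
have B0 : 0 <= B by rewrite /B !mulr_ge0 // ?invr_ge0 // ltW.
have hX0 : 0 <= 2 * h * X by rewrite !mulr_ge0 // ltW.
have step (k : nat) t' : k%:R * h <= t' -> t' <= k%:R * h + h -> t' <= t ->
  let B' := (l1norm (z (k%:R * h) - y (k%:R * h)) + 2 * h * X + B)
           * expR (L * (t' - k%:R * h)) in
  l1norm (z t' - y t') <= B' /\
  (t' = k%:R * h + h -> l1norm (z t' - y t') + 2 * h * X <= B').
  move=> kt tk tt.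
  have k0 : 0 <= k%:R * h by rewrite mulr_ge0 // ltW.
  apply: (averaging_step (q := q)) => //.
  - by move=> s i sa st; apply: qX; [exact: le_trans sa|exact: le_trans tt].
  - by move=> u v au uv vt; apply: yX => //; [exact: le_trans au|exact: le_trans tt].
  - exact: ac_sub acz.
  - exact: ac_sub acy.
  apply: ae_imply aezy => s H sa st.
  have [sy sz] := H (le_trans k0 sa) (le_trans st tt); split => //.
  by apply: sz => //; exact: le_trans tk.
have growth (k : nat) (b s s' : R) : b <= (2 * h * X + k%:R * B) * expR (L * s) ->
    0 <= s -> s <= s' ->
    (b + B) * expR (L * (s' - s)) <= (2 * h * X + k.+1%:R * B) * expR (L * s').
  move=> bk s0 ss'.
  have -> : expR (L * s') = expR (L * s) * expR (L * (s' - s)).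
    by rewrite -expRD; congr expR; ring.
  rewrite mulrA ler_wpM2r ?expR_ge0 //.
  have -> : k.+1%:R * B = k%:R * B + B by rewrite -natr1 mulrDl mul1r.
  rewrite addrA [leRHS]mulrDl.
  apply: lerD => //; rewrite ler_peMr // -expR0 ler_expR mulr_ge0 //.
have grid (k : nat) : k%:R * h <= t ->
    l1norm (z (k%:R * h) - y (k%:R * h)) + 2 * h * X <=
    (2 * h * X + k%:R * B) * expR (L * (k%:R * h)).
  elim: k => [_|k IH].
    by rewrite !mul0r zy0 subrr l1norm0 mulr0 expR0 addr0 add0r mulr1.
  have kS : k.+1%:R * h = k%:R * h + h by rewrite -natr1 mulrDl mul1r.
  move=> kt.
  have [_ H] := step k (k.+1%:R * h) ltac:(lra) ltac:(lra) kt.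
  have kt' : k%:R * h <= t by lra.
  apply: le_trans (H kS) _.
  by apply: growth (IH kt') _ _; [rewrite mulr_ge0 // ltW|lra].
pose k := Num.truncn (t / h).
have /andP[kt tk] : k%:R <= t / h < k.+1%:R by rewrite truncn_itv // divr_ge0 // ltW.
move: kt tk; rewrite ler_pdivlMr // ltr_pdivrMr // -natr1 mulrDl mul1r => kt tk.
have k0 : 0 <= k%:R * h by rewrite mulr_ge0 // ltW.
have [kN|Nk] := ltnP k N.
  have [H _] := step k t kt (ltW tk) (lexx t).
  apply: le_trans H _; apply: le_trans (growth _ _ _ _ (grid k kt) k0 kt) _.
  rewrite ler_wpM2r ?expR_ge0 // lerD2l ler_wpM2r // ler_nat //.
have NkR : N%:R * h <= k%:R * h by rewrite ler_wpM2r ?ler_nat // ltW.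
have tE : t = N%:R * h by lra.
by have := grid N; rewrite -tE => /(_ (lexx t)); rewrite -/B; lra.
Qed.

Theorem lemma4 (R : realType) (d m N : nat) (sigma : R -> R) (K T r : R)
    (A W : 'I_m -> 'M[R]_d) (b : 'I_m -> 'cV[R]_d) (z y : R -> 'cV[R]_d)
    (hd : (1 <= d)%N) (hm : (1 <= m)%N) (hN : (1 <= N)%N)
    (hK : 0 < K)
    (hsigma : forall u v : R, `|sigma u - sigma v| <= K * `|u - v|)
    (hT : 0 < T) (hr : 0 < r)
    (hz : is_solution (switched_field N T sigma A W b) T z)
    (hy : is_solution (fun _ : R => averaged_field sigma A W b) T y)
    (hz0 : l1ball r (z 0)) (hy0 : l1ball r (y 0)) (hzy : z 0 = y 0) :
  let c := m%:R *
    sup (range (fun i : 'I_m => l1opnorm (A i) * l1norm (Sigma sigma (b i)))) in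
  let L := m%:R *
    sup (range (fun i : 'I_m => K * l1opnorm (A i) * l1opnorm (W i))) in
  let Ktilde := m%:R *
    sup (range (fun i : 'I_m => K * l1opnorm (A i) * l1opnorm (W i))) in
  forall t : R, 0 <= t <= T ->
    let X := c + L * (r + c * t) * expR (L * t) in
    l1norm (z t - y t) <=
      (2 * (T / N%:R) * X + Ktilde * X * (T ^+ 2 / (2 * N%:R)))
      * expR (Ktilde * T).
Proof.
move=> c L Ktilde t /andP[t0 tT].
pose X := c + L * (r + c * t) * expR (L * t).
suff : l1norm (z t - y t) <= (2 * (T / N%:R) * X
  + L * X * (T ^+ 2 / (2 * N%:R))) * expR (L * T) by []; clear Ktilde.
have NR : 0 < N%:R :> R by rewrite ltr0n.
have mR : 0 < m%:R :> R by rewrite ltr0n.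
pose q i := layer sigma (A i) (W i) (b i).
have qlip i x x' : m%:R * l1norm (q i x - q i x') <= L * l1norm (x - x').
  rewrite /L -mulrA ler_pM2l //.
  apply: le_trans (layer_lipschitz _ _ _ _ _ hsigma) _.
  rewrite ler_wpM2r ?l1norm_ge0 //.
  exact: (le_sup_range (fun i => K * l1opnorm (A i) * l1opnorm (W i))).
have q0 i : m%:R * l1norm (q i 0) <= c.
  rewrite /c ler_pM2l // /q /layer mulmx0 add0r.
  apply: le_trans (l1norm_mulmx _ _) _.
  exact: (le_sup_range (fun i => l1opnorm (A i) * l1norm (Sigma sigma (b i)))).
have qgrow i x : m%:R * l1norm (q i x) <= c + L * l1norm x.
  have : l1norm (q i x) <= l1norm (q i x - q i 0) + l1norm (q i 0).
    by have := l1norm_leB (q i x) (q i 0); lra.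
  rewrite -(ler_pM2l mR) mulrDr; have := qlip i x 0; have := q0 i.
  by rewrite subr0; lra.
pose i0 := Ordinal hm.
have c0 : 0 <= c by apply: le_trans (q0 i0); rewrite mulr_ge0 ?l1norm_ge0 // ltW.
have L0 : 0 <= L.
  apply: mulr_ge0; first exact: ltW.
  apply: le_trans (le_sup_range (fun i => K * l1opnorm (A i) * l1opnorm (W i)) i0).
  by rewrite !mulr_ge0 ?l1opnorm_ge0 // ltW.
clearbody c L.
have [acz aez] := hz; have [acy aey] := hy.
have aey' : {ae @lebesgue_measure R, forall s, 0 <= s -> s <= T ->
    straddle y s (\sum_i q i (y s))}.
  apply: ae_imply aey => s H s0 sT; apply: is_derive_straddle; apply: H.
  by rewrite in_itv /= s0.
have ygrow s : 0 <= s -> s <= T -> l1norm (y s) <= (r + c * s) * expR (L * s).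
  move=> s0 sT; apply: (@le_trans _ _ ((l1norm (y 0) + c * s) * expR (L * s))).
    apply: growth_bound => //; first exact: ac_sub acy.
    apply: ae_imply aey' => u H u0 us.
    exists (\sum_i q i (y u)); first by apply: H => //; exact: le_trans sT.
    by apply: le_trans (l1norm_sum _) _; exact: sum_le_of_scaled_le.
  by rewrite ler_wpM2r ?expR_ge0 // lerD2r ltW.
have yX s : 0 <= s -> s <= t -> c + L * l1norm (y s) <= X.
  move=> s0 st; rewrite /X lerD2l -mulrA ler_wpM2l //.
  apply: le_trans (ygrow _ s0 (le_trans st tT)) _.
  apply: ler_pM; rewrite ?expR_ge0 ?addr_ge0 ?mulr_ge0 ?(ltW hr) //.
    by rewrite lerD2l ler_wpM2l.
  by rewrite ler_expR ler_wpM2l.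
have X0 : 0 <= X.
  by apply: le_trans (yX 0 (lexx 0) t0); rewrite addr_ge0 ?mulr_ge0 ?l1norm_ge0.
pose h := T / N%:R.
have h0 : 0 < h by exact: divr_gt0.
have TN : T = N%:R * h by rewrite /h mulrCA mulfV ?mulr1 // gt_eqF.
have hm0 : 0 < h / m%:R by exact: divr_gt0.
have slotE (i : nat) : i%:R * T / (m%:R * N%:R) = i%:R * (h / m%:R).
  by rewrite /h; field; rewrite !gt_eqF.
have yLip u v : 0 <= u -> u <= v -> v <= t -> l1norm (y v - y u) <= X * (v - u).
  move=> u0 uv vt; apply: increment_bound => //.
    by apply: ac_sub acy => //; exact: le_trans tT.
  apply: ae_imply aey' => s H us sv; have s0 := le_trans u0 us.
  have st := le_trans sv vt.
  exists (\sum_i q i (y s)); first by apply: H => //; exact: le_trans tT.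
  apply: le_trans (yX _ s0 st); apply: le_trans (l1norm_sum _) _.
  exact: sum_le_of_scaled_le.
have main := @averaging_bound R d m N h t L X q z y hm h0 L0 X0 t0
  (eq_ind _ (fun x => t <= x) tT _ TN) qlip _ yLip (ac_sub (lexx 0) tT acz)
  (ac_sub (lexx 0) tT acy) hzy.
apply: le_trans (main _ _) _; last 1 first.
- have -> : 2 * h * X + N%:R * (L * X * (h ^+ 2 / 2)) =
            2 * (T / N%:R) * X + L * X * (T ^+ 2 / (2 * N%:R)).
    by rewrite /h; field; rewrite gt_eqF.
  apply: ler_wpM2l; last by rewrite ler_expR ler_wpM2l.
  by rewrite !addr_ge0 ?mulr_ge0 ?invr_ge0 ?mulr_ge0 // ltW.
- by move=> s i s0 st; apply: le_trans (qgrow _ _) (yX _ s0 st).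
(* off the grid of switching times, every instant is interior to one slot *)
pose grid := range (fun j : nat * nat => j.1%:R * h + j.2%:R * (h / m%:R)).
have cgrid : countable grid.
  by apply: sub_countable (card_image_le _ _) _; exact: countableP.
have := @filterI _ _ (ae_filter_ringOfSetsType lebesgue_measure) _ _
  (ae_notin_countable cgrid)
  (@filterI _ _ (ae_filter_ringOfSetsType lebesgue_measure) _ _ aey' aez).
apply: ae_imply => s [/= nogrid [ys zs]] s0 st.
have sT := le_trans st tT; split; first exact: ys.
move=> k ks sk.
have skS : s < k%:R * h + h.
  rewrite lt_neqAle sk andbT; apply/eqP => se; apply: nogrid.
  by exists (k.+1, 0%N) => //=; rewrite se mul0r addr0 -natr1 mulrDl mul1r.
have [i /andP[si is_]] := slot_exists hm h0 ks skS.
exists i; split => //.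
  rewrite lt_neqAle si andbT; apply/eqP => se; apply: nogrid.
  by exists (k, nat_of_ord i).
have -> : m%:R *: q i (z s) = switched_field N T sigma A W b s (z s).
  have kE : k%:R * T / N%:R = k%:R * h by rewrite mulrA.
  have := @switched_fieldE R d m N T sigma A W b k i (s - k%:R * h) (z s) hN hT.
  by rewrite kE subrK !slotE => -> //; apply/andP; split; lra.
by apply: is_derive_straddle; apply: zs; rewrite in_itv /= s0.
Qed.
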